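(* Let $P\subset\mathbb{R}^d$ be a compact convex set of diameter $D=\sup_{x,y\in P}\|x-y\|$ with $P=\mathrm{conv}(V(P))$, $V(P)\subset P$. Let $f:\mathbb{R}^d\to\mathbb{R}$ be a differentiable, $L$-smooth convex function and let $x^\ast$ be a minimizer of $f$ over $P$. Let $J\ge1$ and let $x_0,x_1,x_2,\dots$ be the iterates in $P$ generated by the lazified BPCG algorithm (described in the context) with accuracy parameter $J$, started at some $x_0\in V(P)$. (A) If $f$ is $\mu$-strongly convex and $P$ is a polytope (with vertex set $V(P)$) with pyramidal width $\delta>0$, then there is a constant $c>0$ independent of $T$ such that $$f(x_T)-f(x^\ast)=O(\exp(-c\,T))\qquad(T\to\infty).$$ (B) If $f$ is only convex and $L$-smooth, then $$f(x_T)-f(x^\ast)=O\left(\frac1T\right)\qquad(T\to\infty).$$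
   Context: $\langle\cdot,\cdot\rangle$ and $\|\cdot\|$ are the Euclidean inner product and norm. A differentiable $f$ is $L$-smooth if $f(y)-f(x)-\langle\nabla f(x),y-x\rangle\le\frac L2\|y-x\|^2$ for all $x,y\in\mathbb{R}^d$, and $\mu$-strongly convex ($\mu>0$) if $f(y)-f(x)-\langle\nabla f(x),y-x\rangle\ge\frac\mu2\|y-x\|^2$ for all $x,y\in\mathbb{R}^d$. Pyramidal width (Lacoste-Julien and Jaggi). For a finite set $A$, a point $x\in\mathrm{conv}(A)$ and $r\neq0$, let $\mathcal S_x$ be the family of subsets $S\subset A$ such that $x$ is a convex combination of the elements of $S$ with all weights strictly positive, and $\mathrm{PdirW}(A,r,x)=\min_{S\in\mathcal S_x}\max_{a\in A,\,s\in S}\langle r/\|r\|,a-s\rangle$. The pyramidal width of a polytope $P=\mathrm{conv}(V(P))$ is the infimum of $\mathrm{PdirW}(K\cap V(P),r,x)$ over all faces $K$ of $P$, all $x\in K$, and all $r\in\mathrm{cone}(K-x)\setminus\{0\}$. Lazified BPCG algorithm. It maintains iterates $x_t\in P$, finite active sets $S_t\subset V(P)$, gap estimates $\Phi_t\ge 0$, and an explicit convex combination $x_t=\sum_{v\in S_t}c[x_t](v)\,v$ (nonnegative weights summing to $1$). Start: $x_0\in V(P)$, $S_0=\{x_0\}$, $c[x_0](x_0)=1$, $\Phi_0=\frac12\max_{v\in P}\langle\nabla f(x_0),x_0-v\rangle$. For $t=0,1,2,\dots$: - choose $a_t\in\mathrm{argmax}_{v\in S_t}\langle\nabla f(x_t),v\rangle$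 and $s_t\in\mathrm{argmin}_{v\in S_t}\langle\nabla f(x_t),v\rangle$; - if $\langle\nabla f(x_t),a_t-s_t\rangle\ge\Phi_t$: set $d_t=a_t-s_t$, $\Lambda_t^\ast=c[x_t](a_t)$, choose $\lambda_t\in\mathrm{argmin}_{\lambda\in[0,\Lambda_t^\ast]}f(x_t-\lambda d_t)$, set $x_{t+1}=x_t-\lambda_td_t$, $\Phi_{t+1}=\Phi_t$, and $S_{t+1}=S_t$ if $\lambda_t<\Lambda_t^\ast$ (descent step), $S_{t+1}=S_t\setminus\{a_t\}$ otherwise (drop step); - otherwise choose $w_t\in\mathrm{argmin}_{v\in V(P)}\langle\nabla f(x_t),v\rangle$ (minimum assumed attained). If $\langle\nabla f(x_t),x_t-w_t\rangle\ge\Phi_t/J$ (FW step): set $d_t=x_t-w_t$, choose $\lambda_t\in\mathrm{argmin}_{\lambda\in[0,1]}f(x_t-\lambda d_t)$, set $x_{t+1}=x_t-\lambda_td_t$, $\Phi_{t+1}=\Phi_t$, $S_{t+1}=S_t\cup\{w_t\}$. Otherwise (gap step): set $x_{t+1}=x_t$, $\Phi_{t+1}=\Phi_t/2$, $S_{t+1}=S_t$. Weights are updated accordingly (pairwise step: move weight $\lambda_t$ from $a_t$ to $s_t$; FW step: multiply all weights by $1-\lambda_t$ and add $\lambda_t$ to the weight of $w_t$). *)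

(* Defs.v *)
From HB Require Import structures.
From mathcomp Require Import all_boot all_order all_algebra finmap.
From mathcomp Require Import all_classical all_reals all_analysis.
Set Implicit Arguments.
Unset Strict Implicit.
Unset Printing Implicit Defensive.
Import Order.TTheory GRing.Theory Num.Theory.
Import numFieldNormedType.Exports.
Local Open Scope classical_set_scope.
Local Open Scope ring_scope.

Section Euclidean.
Context {R : realType} {d : nat}.
Implicit Types (x y v w : 'rV[R]_d) (f : 'rV[R]_d -> R).

Definition dot v w : R := \sum_i v 0 i * w 0 i.

(* The library norm `|v| on 'rV[R]_d is the sup norm, hence this definition.
   The two norms define the same topology and the same differentials. *)
Definition enorm v : R := Num.sqrt (dot v v).

Definition grad f x : 'rV[R]_d := \row_i 'D_(delta_mx 0 i) f x.

Definition smooth (L : R) f := forall x y,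
  f y - f x - dot (grad f x) (y - x) <= L / 2 * enorm (y - x) ^+ 2.

Definition strongly_convex (mu : R) f := forall x y,
  f y - f x - dot (grad f x) (y - x) >= mu / 2 * enorm (y - x) ^+ 2.

Definition diameter (P : set 'rV[R]_d) : R :=
  sup [set enorm (z.1 - z.2) | z in P `*` P].

End Euclidean.

Definition argmin {R : realType} {T : Type} (A : set T) (g : T -> R) : set T :=
  [set x | A x /\ forall y, A y -> g x <= g y].

Definition argmax {R : realType} {T : Type} (A : set T) (g : T -> R) : set T :=
  [set x | A x /\ forall y, A y -> g y <= g x].

Section Polytopes.
Context {R : realType} {d : nat}.
Implicit Types (A P K V : set 'rV[R]_d) (S : {fset 'rV[R]_d})
  (c : 'rV[R]_d -> R) (x r : 'rV[R]_d).

Definition conv_hull A : set 'rV[R]_d :=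
  [set x | exists S c, [/\ [set` S] `<=` A,
    forall v, v \in S -> 0 <= c v,
    \sum_(v <- S) c v = 1 & x = \sum_(v <- S) c v *: v]].

Definition conic_hull A : set 'rV[R]_d :=
  [set x | exists S c, [/\ [set` S] `<=` A,
    forall v, v \in S -> 0 <= c v & x = \sum_(v <- S) c v *: v]].

Definition polytope P := exists S, P = conv_hull [set` S].

(* Face of a convex set in the sense of Rockafellar; P itself is a face.  For a
   polytope the nonempty faces are the nonempty intersections with supporting
   hyperplanes, together with P. *)
Definition face P K :=
  [/\ K `<=` P, @convex_set R 'rV[R]_d K &
    forall x y (t : R), P x -> P y -> 0 < t < 1 ->
      K ((1 - t) *: x + t *: y) -> K x /\ K y].

Definition vertices P : set 'rV[R]_d := [set v | face P [set v]].

Definition proper_supports A x : set {fset 'rV[R]_d} :=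
  [set S : {fset 'rV[R]_d} | [set` S] `<=` A /\ exists c, [/\ forall v, v \in S -> 0 < c v,
    \sum_(v <- S) c v = 1 & x = \sum_(v <- S) c v *: v]].

(* For finite A and x in conv_hull A the infimum and the supremum range over
   finite nonempty sets, so they are a minimum and a maximum. *)
Definition pdir_width A r x : \bar R :=
  ereal_inf [set
    ereal_sup [set (dot ((enorm r)^-1 *: r) (z.1 - z.2))%:E
              | z in A `*` [set` S]]
  | S in proper_supports A x].

(* Extended-real valued because the infimum is over the empty family (+oo) when
   P is a single point. *)
Definition pyramidal_width P : \bar R :=
  ereal_inf [set w | exists K x r, [/\ face P K, K x,
    conic_hull [set y - x | y in K] r, r != 0 &
    w = pdir_width (K `&` vertices P) r x]].

End Polytopes.

Record bpcg_state (R : realType) (d : nat) := BPCGState {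
  iterate : 'rV[R]_d;
  active  : {fset 'rV[R]_d};
  weight  : 'rV[R]_d -> R;  (* c[x_t], equal to 0 outside the active set *)
  gap     : R               (* the estimate Phi_t *)
}.

Section LazifiedBPCG.
Context {R : realType} {d : nat}.
Variables (f : 'rV[R]_d -> R) (P V : set 'rV[R]_d) (J : R).
Implicit Types (st : bpcg_state R d) (a s w x : 'rV[R]_d) (lam : R).

Definition away_vertex st a :=
  argmax [set` active st] (dot (grad f (iterate st))) a.

Definition local_fw_vertex st s :=
  argmin [set` active st] (dot (grad f (iterate st))) s.

Definition fw_vertex st w := argmin V (dot (grad f (iterate st))) w.

Definition line_search x (dir : 'rV[R]_d) (lam_max lam : R) :=
  argmin `[0, lam_max] (fun l => f (x - l *: dir)) lam.

Definition pairwise_update st a s lam := BPCGState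
  (iterate st - lam *: (a - s))
  (if lam < weight st a then active st else (active st `\ a)%fset)
  (fun v => weight st v - lam * (v == a)%:R + lam * (v == s)%:R)
  (gap st).

Definition fw_update st w lam := BPCGState
  (iterate st - lam *: (iterate st - w))
  (w |` active st)%fset
  (fun v => (1 - lam) * weight st v + lam * (v == w)%:R)
  (gap st).

Definition gap_update st := BPCGState
  (iterate st) (active st) (weight st) (gap st / 2).

Inductive bpcg_step st : bpcg_state R d -> Prop :=
| PairwiseStep a s lam of
    away_vertex st a & local_fw_vertex st s &
    gap st <= dot (grad f (iterate st)) (a - s) &
    line_search (iterate st) (a - s) (weight st a) lam :
    bpcg_step st (pairwise_update st a s lam)
| FWStep a s w lam of
    away_vertex st a & local_fw_vertex st s &
    dot (grad f (iterate st)) (a - s) < gap st &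
    fw_vertex st w &
    gap st / J <= dot (grad f (iterate st)) (iterate st - w) &
    line_search (iterate st) (iterate st - w) 1 lam :
    bpcg_step st (fw_update st w lam)
| GapStep a s w of
    away_vertex st a & local_fw_vertex st s &
    dot (grad f (iterate st)) (a - s) < gap st &
    fw_vertex st w &
    dot (grad f (iterate st)) (iterate st - w) < gap st / J :
    bpcg_step st (gap_update st).

Definition bpcg_start st := exists x0 v0, [/\ V x0,
  argmax P (fun v => dot (grad f x0) (x0 - v)) v0 &
  st = BPCGState x0 [fset x0]%fset (fun v => (v == x0)%:R)
         (2^-1 * dot (grad f x0) (x0 - v0))].

Definition bpcg_run (st : nat -> bpcg_state R d) :=
  bpcg_start (st 0%N) /\ forall t, bpcg_step (st t) (st t.+1).

End LazifiedBPCG.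

(* Main.v *)
Require Import Defs.
From mathcomp Require Import all_boot all_order all_algebra finmap.
From mathcomp Require Import all_classical all_reals all_analysis.
From mathcomp Require Import ring lra.
Set Implicit Arguments.
Unset Strict Implicit.
Unset Printing Implicit Defensive.
Import Order.TTheory GRing.Theory Num.Theory.
Import numFieldNormedType.Exports.
Local Open Scope classical_set_scope.
Local Open Scope ring_scope.

(** Write [h] for the primal gap [f x - f xstar] of the current iterate, [Phi]
    for the gap estimate and [S] for the active set.  Two facts drive both rates.

    A step that is neither a gap step nor a drop step decreases [f] by at least
    a fixed multiple of [Phi ^+ 2]: smoothness bounds [f] along the search
    direction by a parabola, and the minimizer over the admissible step sizes
    does as well as the particular step [Phi / (J * M)], where [M] bounds the
    curvature of the parabola ([step_outcomeP]).  On a pairwise step that does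
    not exhaust the weight of the away vertex, the minimizer lies in the interior
    of the interval or at [0], so by convexity it minimizes over the whole
    half-line and the admissible length does not matter.  A drop step may gain
    nothing, but it shrinks [S], and only Frank-Wolfe steps enlarge [S], by one.

    On a gap step both the Frank-Wolfe gap and the local pairwise gap are small,
    so [h <= Phi].  Since [h] does not increase and [h <= 2 * Phi] holds at the
    start, [h <= 2 * Phi] holds at all times.

    Hence, for any function [psi] which a halving of [Phi] increases by at least
    [rho + 3 * h / Phi ^+ 2], the potential
    [psi Phi - h / Phi ^+ 2 - rho / 2 * #|S|] grows by [rho / 2] at every step,
    whichever its kind: the term [h / Phi ^+ 2] falls by a constant on a
    productive step and is multiplied by [4] on a gap step, and the term in [#|S|]
    pays for the drop steps ([potential_growth]).  So [psi Phi] grows linearly.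

    For convex [f], take [psi Phi = 4 / Phi]: on a gap step [h <= Phi] gives
    [3 * h / Phi ^+ 2 <= 3 / Phi], so [1 / Phi] grows linearly ([sublinear_rate]).
    For strongly convex [f] on a polytope, gap steps satisfy the better bound
    [h <= C * Phi ^+ 2], so that a logarithm is enough: [psi Phi = - K * ln Phi],
    and [Phi] decays geometrically ([linear_rate]).

    That better bound ([quadratic_gap_bound]) is where the pyramidal width
    enters.  Let [r = - grad f x] and let [y] be its projection on the cone of
    feasible directions at [x].  The residual [u = r - y] is nonpositive on
    feasible directions, hence it exposes a face [K] containing [x], and [K] also
    contains every vertex with positive weight in [x]; moreover [y] is a feasible
    direction of [K].  On [K] the linear forms of [r] and [y] have the same
    variation, so the definition of the width applied to [K] and [y] bounds
    [delta * enorm y] by the gap between the away vertex and the Frank-Wolfe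
    vertex, which is at most [2 * Phi] ([pyramidal_gap]).  Since [r] is below [y]
    on feasible directions, strong convexity yields
    [h <= dot y e - mu / 2 * dot e e <= dot y y / (2 * mu)] with [e = xstar - x]. *)

(** * The Euclidean inner product *)

Section Dot.
Context {R : realType} {d : nat}.
Implicit Types (u v w z : 'rV[R]_d) (t : R).

Lemma dotC v w : dot v w = dot w v.
Proof. by apply: eq_bigr => i _; rewrite mulrC. Qed.

Lemma dotDr u v w : dot u (v + w) = dot u v + dot u w.
Proof. by rewrite -big_split; apply: eq_bigr => i _; rewrite mxE mulrDr. Qed.

Lemma dotZr t u v : dot u (t *: v) = t * dot u v.
Proof. by rewrite mulr_sumr; apply: eq_bigr => i _; rewrite mxE mulrCA. Qed.

Lemma dotNr u v : dot u (- v) = - dot u v.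
Proof. by rewrite -scaleN1r dotZr mulN1r. Qed.

Lemma dot0r u : dot u 0 = 0.
Proof. by rewrite -(scale0r 0) dotZr mul0r. Qed.

Lemma dot0l u : dot 0 u = 0.
Proof. by rewrite dotC dot0r. Qed.

Lemma dotBr u v w : dot u (v - w) = dot u v - dot u w.
Proof. by rewrite dotDr dotNr. Qed.

Lemma dotDl u v w : dot (v + w) u = dot v u + dot w u.
Proof. by rewrite !(dotC _ u) dotDr. Qed.

Lemma dotZl t u v : dot (t *: v) u = t * dot v u.
Proof. by rewrite !(dotC _ u) dotZr. Qed.

Lemma dotNl u v : dot (- v) u = - dot v u.
Proof. by rewrite !(dotC _ u) dotNr. Qed.

Lemma dotBl u v w : dot (v - w) u = dot v u - dot w u.
Proof. by rewrite !(dotC _ u) dotBr. Qed.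

Definition dotE := (dotDl, dotDr, dotBl, dotBr, dotNl, dotNr, dotZl, dotZr).

Lemma dot_ge0 v : 0 <= dot v v.
Proof. by apply: sumr_ge0 => i _; rewrite -expr2 sqr_ge0. Qed.

Lemma dot_eq0 v : (dot v v == 0) = (v == 0).
Proof.
apply/idP/eqP => [|->]; last by rewrite dot0r.
rewrite psumr_eq0 => [/allP v0|i _]; last by rewrite -expr2 sqr_ge0.
apply/rowP => i; rewrite mxE; have := v0 i (mem_index_enum i).
by rewrite mulf_eq0 orbb => /eqP.
Qed.

Lemma enorm_sqr v : enorm v ^+ 2 = dot v v.
Proof. by rewrite sqr_sqrtr ?dot_ge0. Qed.

Lemma enorm_gt0 v : v != 0 -> 0 < enorm v.
Proof. by move=> v0; rewrite sqrtr_gt0 lt_neqAle eq_sym dot_eq0 v0 dot_ge0. Qed.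

Lemma dot_sumr u (S : {fset 'rV[R]_d}) (c : 'rV[R]_d -> R) :
  dot u (\sum_(v <- S) c v *: v) = \sum_(v <- S) c v * dot u v.
Proof.
elim/big_rec2 : _ => [|v x y _ <-]; first exact: dot0r.
by rewrite dotDr dotZr.
Qed.

Lemma dot_avg_le u (S : {fset 'rV[R]_d}) (c : 'rV[R]_d -> R) (b : R) :
  (forall v, v \in S -> 0 <= c v) -> \sum_(v <- S) c v = 1 ->
  (forall v, v \in S -> dot u v <= b) ->
  dot u (\sum_(v <- S) c v *: v) <= b.
Proof.
move=> c0 c1 ub; rewrite dot_sumr -[leRHS]mul1r -c1 mulr_suml !big_seq.
by apply: ler_sum => v vS; rewrite ler_wpM2l ?c0 ?ub.
Qed.

Lemma dot_conv_hull_le u (A : set 'rV[R]_d) (b : R) x :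
  conv_hull A x -> (forall v, A v -> dot u v <= b) -> dot u x <= b.
Proof.
move=> [S [c [SA c0 c1 ->]]] ub; apply: dot_avg_le => // v vS.
exact/ub/SA.
Qed.

End Dot.

(** * Sums over finite sets *)

Section FsetSums.
Context {R : nzRingType} {T : choiceType} {U : lmodType R}.
Implicit Types (S : {fset T}) (F : T -> U).

Lemma sum_indic S z t F : z \in S ->
  \sum_(v <- S) (t * (v == z)%:R) *: F v = t *: F z.
Proof.
move=> zS; rewrite (bigD1_seq z) ?fset_uniq //= eqxx mulr1 big1 ?addr0 //.
by move=> v /negbTE ->; rewrite mulr0 scale0r.
Qed.

Lemma sum_fsetU1 S z F : (z \notin S -> F z = 0) ->
  \sum_(v <- (z |` S)%fset) F v = \sum_(v <- S) F v.
Proof.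
move=> F0; apply/esym/big_fset_incl; first exact: fsubsetUr.
by move=> v; rewrite in_fset1U => /orP[/eqP-> //|->].
Qed.

End FsetSums.

(** * Projection on finitely generated cones *)

Section Cones.
Context {R : realType} {d : nat}.
Implicit Types (u v w z r p y : 'rV[R]_d) (s : seq 'rV[R]_d) (t : R).

(** The conic hull of a list, by recursion on the generators so that the
    projection below can be built one generator at a time. *)
Fixpoint cone s : set 'rV[R]_d :=
  if s is z :: s' then [set y | exists2 t, 0 <= t & cone s' (y - t *: z)]
  else [set 0].

Lemma cone0 s : cone s 0.
Proof. by elim: s => //= z s IH; exists 0; rewrite // scale0r subr0. Qed.

Lemma mem_cone s z : z \in s -> cone s z.
Proof.
elim: s => //= w s IH; rewrite inE => /predU1P[->|/IH sz].
  by exists 1; rewrite // scale1r subrr; apply: cone0.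
by exists 0; rewrite // scale0r subr0.
Qed.

Definition reject z v := v - (dot v z / dot z z) *: z.

Lemma rejectBZ z v t w : reject z (v - t *: w) = reject z v - t *: reject z w.
Proof. by rewrite /reject !dotE; apply/rowP => i; rewrite !mxE; ring. Qed.

Lemma reject0 z : reject z 0 = 0.
Proof. by rewrite /reject dot0l mul0r scale0r subr0. Qed.

Lemma dot_reject z v : z != 0 -> dot (reject z v) z = 0.
Proof.
by rewrite -dot_eq0 => z0; rewrite !dotE -mulrA mulVf // mulr1 subrr.
Qed.

Lemma cone_map_reject z s p : cone s p -> cone (map (reject z) s) (reject z p).
Proof.
elim: s p => [p ->|w s IH p [t t0 /IH sp]] /=.
  exact: reject0.
by exists t; rewrite // -rejectBZ.
Qed.

Lemma map_reject_cone z s q :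
  cone (map (reject z) s) q -> exists2 p, cone s p & q = reject z p.
Proof.
elim: s q => [q ->|w s IH q [t t0 /IH[p sp qp]]] /=.
  by exists 0; rewrite ?reject0.
exists (p + t *: w); first by exists t; rewrite // addrK.
rewrite -[p](addrK (t *: w)) rejectBZ in qp.
by rewrite -(subrK (t *: reject z w) q) qp subrK.
Qed.

(** Projection on the cone, characterized by Moreau's conditions.  Finitely many
    generators make topology superfluous.  Let [y0] be the projection on the cone
    of the generators other than [z].  If [r - y0] is at a right or obtuse angle
    with [z], then [y0] is already the answer.  Otherwise [z] must occur in the
    answer with a positive coefficient, so the residual is orthogonal to [z]: one
    solves the smaller problem in the hyperplane orthogonal to [z], and restores
    the component along [z]. *)
Lemma cone_projection s r : exists y, [/\ cone s y,
  forall p, cone s p -> dot (r - y) p <= 0 & dot (r - y) y = 0].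
Proof.
have [n] := ubnP (size s); elim: n s r => // n IH [|z s] r /=.
  by move=> _; exists 0; split=> [//|p ->|]; rewrite dot0r.
rewrite ltnS => sn; have [y0 [sy0 y0p y0y0]] := IH s r sn.
have [zle|zgt] := leP (dot (r - y0) z) 0.
  exists y0; split=> //; first by exists 0; rewrite ?scale0r ?subr0.
  move=> p [t t0 /y0p]; rewrite dotBr dotZr => ?; nra.
have z0 : z != 0 by apply: contraTneq zgt => ->; rewrite dot0r ltxx.
have [|_ [/map_reject_cone[p sp ->] yp yy]] := IH (map (reject z) s) (reject z r).
  by rewrite size_map.
set t := (dot r z - dot p z) / dot z z.
have urE : reject z r - reject z p = r - (p + t *: z).
  by rewrite /reject /t; apply/rowP => i; rewrite !mxE; ring.
set y := p + t *: z in urE; rewrite urE in yp yy.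
have uz : dot (r - y) z = 0 by rewrite -urE dotBl !dot_reject // subrr.
have ur q : dot (r - y) (reject z q) = dot (r - y) q.
  by rewrite dotBr dotZr uz mulr0 subr0.
have uq q : cone s q -> dot (r - y) q <= 0.
  by move=> /(cone_map_reject z)/yp; rewrite ur.
have uy : dot (r - y) y = 0 by rewrite -[RHS]yy ur dotDr dotZr uz mulr0 addr0.
exists y; split=> //; last first.
  by move=> q [l l0 /uq]; rewrite dotBr dotZr uz mulr0 subr0.
exists t; last by rewrite addrK.
(* [y] projects [r] on the cone of [s] plus the line of [z].  If [t < 0], adding
   the variational inequalities of [y] and [y0] makes the square of [y - y0]
   negative. *)
rewrite leNgt; apply/negP => t0.
have dy0y : dot (r - y0) y = dot (r - y0) p + t * dot (r - y0) z.
  by rewrite dotDr dotZr.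
have := dot_ge0 (y - y0); have := uq _ sy0; have := y0p _ sp.
have -> : dot (y - y0) (y - y0) = dot (r - y0) y - dot (r - y0) y0
    - dot (r - y) y + dot (r - y) y0 by rewrite !dotE; ring.
rewrite uy y0y0 dy0y; nra.
Qed.

Lemma conic_hullD (A : set 'rV[R]_d) p t z :
  A z -> 0 <= t -> conic_hull A p -> conic_hull A (p + t *: z).
Proof.
move=> Az t0 [S [c [SA c0 ->]]].
pose c1 v := if v \in S then c v else 0.
have c1_ge0 v : 0 <= c1 v by rewrite /c1; case: ifP => // /c0.
exists (z |` S)%fset, (fun v => c1 v + t * (v == z)%:R); split.
- by move=> v /=; rewrite in_fset1U => /orP[/eqP->|/SA].
- by move=> v _; rewrite addr_ge0 ?mulr_ge0 ?ler0n.
under [RHS]eq_bigr => v _ do rewrite scalerDl.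
rewrite big_split /= sum_indic ?fset1U1 // sum_fsetU1 => [|/negbTE zS]; last first.
  by rewrite /c1 zS scale0r.
by congr (_ + _); rewrite !big_seq; apply: eq_bigr => v vS; rewrite /c1 vS.
Qed.

(** If [u] is nonpositive on the generators and vanishes at [p], every generator
    that contributes to [p] lies in the hyperplane orthogonal to [u]. *)
Lemma cone_exposed u s p : cone s p -> (forall z, z \in s -> dot u z <= 0) ->
  dot u p = 0 -> conic_hull [set z | z \in s /\ dot u z = 0] p.
Proof.
suff H A q : cone s q -> (forall z, z \in s -> dot u z <= 0) ->
    (forall z, z \in s -> dot u z = 0 -> A z) ->
    dot u q <= 0 /\ (dot u q = 0 -> conic_hull A q).
  by move=> sp su; have [|_ ] := H [set z | z \in s /\ dot u z = 0] p sp su.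
elim: s q => [q -> _ _|z s IH q [t t0 sq] su sA] /=.
  rewrite dot0r; split=> // _; exists fset0, (fun=> 0); split=> //.
  by rewrite big_seq_fset0.
have [|z' z's|uq qA] := IH _ sq.
- by move=> z' z's; apply: su; rewrite inE z's orbT.
- by apply: sA; rewrite inE z's orbT.
have uz : dot u z <= 0 by apply: su; rewrite inE eqxx.
rewrite dotBr dotZr in uq qA; split; first by nra.
move=> uq0; rewrite -[q](subrK (t *: z)).
have /eqP : t * dot u z = 0 by nra.
have uq1 : dot u q - t * dot u z = 0 by nra.
rewrite mulf_eq0 => /orP[/eqP t_0|/eqP uz0].
  by rewrite t_0 scale0r addr0; move: (qA uq1); rewrite t_0 scale0r subr0.
apply: conic_hullD (qA uq1) => //; apply: sA => //; by rewrite inE eqxx.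
Qed.

End Cones.

(** * Faces and the pyramidal width *)

Section Pyramid.
Context {R : realType} {d : nat}.
Implicit Types (u x r : 'rV[R]_d) (P V : set 'rV[R]_d) (S : {fset 'rV[R]_d}).

Lemma face_exposed P u b : @convex_set R 'rV[R]_d P ->
  (forall z, P z -> dot u z <= b) -> face P [set z | P z /\ dot u z = b].
Proof.
move=> Pconv ub; split=> [z []//|x y t /set_mem[Px xb] /set_mem[Py yb]|].
  apply/mem_set; split; first exact/set_mem/Pconv/mem_set/Py/mem_set.
  rewrite [X in dot _ X](_ : _ = t%:inum *: x + (1 - t%:inum) *: y) //.
  by rewrite dotDr !dotZr xb yb; ring.
move=> x y t Px Py /andP[t0 t1] [_]; rewrite dotDr !dotZr => uxy.
have ux := ub _ Px; have uy := ub _ Py.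
suff: dot u x = b /\ dot u y = b by case.
split; nra.
Qed.

Lemma pyramidal_width_le P S (K : set 'rV[R]_d) x r g :
  face P K -> K x -> conic_hull [set y - x | y in K] r -> r != 0 ->
  proper_supports (K `&` vertices P) x S ->
  (forall v s, (K `&` vertices P) v -> s \in S -> dot r (v - s) <= g) ->
  (pyramidal_width P <= (g / enorm r)%:E)%E.
Proof.
move=> KP Kx Kr r0 xS rg.
apply: (@le_trans _ _ (pdir_width (K `&` vertices P) r x)).
  by apply: ereal_inf_lbound; exists K, x, r.
apply: le_trans (ereal_inf_lbound _) _; first by exists S.
apply: ge_ereal_sup => _ [[v s] /= [Av Ss] <-].
by rewrite lee_fin dotZl mulrC ler_wpM2r ?invr_ge0 ?sqrtr_ge0 ?rg.
Qed.

Lemma proper_supports_positive (A : set 'rV[R]_d) S (c : 'rV[R]_d -> R) :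
  [set` S] `<=` A -> (forall v, v \in S -> 0 <= c v) -> \sum_(v <- S) c v = 1 ->
  proper_supports A (\sum_(v <- S) c v *: v) [fset v in S | 0 < c v]%fset.
Proof.
move=> SA c0 c1.
have sub : ([fset v in S | 0 < c v] `<=` S)%fset.
  by apply/fsubsetP=> v; rewrite !inE => /andP[].
have out v : v \in S -> v \notin [fset v in S | 0 < c v]%fset -> c v = 0.
  move=> vS; rewrite !inE vS /= -leNgt => cv; apply/eqP.
  by rewrite eq_le cv c0.
split=> [v|]; first by move/(fsubsetP sub)/SA.
exists c; split=> [v|//|]; first by rewrite !inE => /andP[].
  by rewrite -c1; exact: big_fset_incl.
by apply/esym/big_fset_incl => // v vS /(out _ vS) ->; rewrite scale0r.
Qed.

(** An average attains an upper bound of its terms only if every term of positive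
    weight attains it. *)
Lemma avg_exposed u S (c : 'rV[R]_d -> R) (b : R) :
  (forall v, v \in S -> 0 <= c v) -> \sum_(v <- S) c v = 1 ->
  (forall v, v \in S -> dot u v <= b) -> dot u (\sum_(v <- S) c v *: v) = b ->
  forall s, s \in S -> 0 < c s -> dot u s = b.
Proof.
move=> c0 c1 ub; rewrite dot_sumr => sb s sS cs.
have : \sum_(v <- S) c v * (b - dot u v) = 0.
  under eq_bigr => v _ do rewrite mulrBr.
  by rewrite sumrB sb -mulr_suml c1 mul1r subrr.
rewrite (big_fsetD1 s) //= => sum0.
have : 0 <= \sum_(v <- (S `\ s)%fset) c v * (b - dot u v).
  rewrite big_seq; apply: sumr_ge0 => v; rewrite in_fsetD1 => /andP[_ vS].
  by rewrite mulr_ge0 ?c0 ?subr_ge0 ?ub.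
have := ub _ sS; nra.
Qed.

(** The form in which the pyramidal width is used.  The vector [r] need not be a
    feasible direction of any face, whereas the definition of the width only
    speaks of such directions; [y] is the projection of [r] on the feasible cone
    at [x], and the face is the one exposed by [r - y]. *)
Lemma pyramidal_gap P S (c : 'rV[R]_d -> R) x r g (del : R) :
  @convex_set R 'rV[R]_d P -> polytope P -> P x ->
  0 < del -> (del%:E <= pyramidal_width P)%E ->
  [set` S] `<=` vertices P -> (forall v, v \in S -> 0 <= c v) ->
  \sum_(v <- S) c v = 1 -> x = \sum_(v <- S) c v *: v ->
  (forall v s, vertices P v -> s \in S -> dot r (v - s) <= g) ->
  exists y, (forall z, P z -> dot r (z - x) <= dot y (z - x)) /\
    del ^+ 2 * dot y y <= g ^+ 2.
Proof.
move=> Pconv [G PG] Px del0 del_le SV c0 c1 xE rg.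
have VP v : vertices P v -> P v by case=> + _ _; exact.
have [y [Gy yp yy]] := cone_projection [seq v - x | v <- G] r.
set u := r - y in yp yy.
have ub z : P z -> dot u z <= dot u x.
  rewrite {1}PG => Pz; apply: dot_conv_hull_le Pz _ => v vG.
  by rewrite -subr_le0 -dotBr yp //; apply/mem_cone/map_f.
exists y; split=> [z /ub uz|].
  by rewrite -subr_ge0 -dotBl -opprB dotNl -/u dotBr opprB subr_ge0.
have [->|y0] := eqVneq y 0; first by rewrite dot0r mulr0 sqr_ge0.
pose K := [set z | P z /\ dot u z = dot u x].
have KP : face P K by exact: face_exposed.
have S0 := proper_supports_positive SV c0 c1; rewrite -xE in S0.
have SK : proper_supports (K `&` vertices P) x [fset v in S | 0 < c v]%fset.
  case: S0 => _ pc; split=> // s /= sS.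
  have := sS; rewrite !inE => /andP[s1 cs]; have Vs := SV _ s1.
  split=> //; split; first exact: VP.
  by apply: (@avg_exposed u S c) => // [v /SV/VP/ub|]; rewrite -?xE.
have Ky : conic_hull [set z - x | z in K] y.
  have [|Q [e [QA e0 yE]]] := cone_exposed Gy _ yy.
    by move=> _ /mapP[v vG ->]; rewrite yp //; apply/mem_cone/map_f.
  exists Q, e; split=> // q /QA /= [/mapP[v vG ->] uv]; exists v => //.
  split; last by apply/eqP; rewrite -subr_eq0 -dotBr uv.
  rewrite PG; exists [fset v]%fset, (fun=> 1).
  split; rewrite ?big_seq_fset1 ?scale1r //.
  by move=> w /=; rewrite in_fset1 => /eqP ->.
have := le_trans del_le (pyramidal_width_le (g := g) KP _ Ky y0 SK _).
rewrite lee_fin ler_pdivlMr ?enorm_gt0 // => H.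
have : del * enorm y <= g.
  apply: H => // v s [[Pv uv] Vv]; rewrite !inE => /andP[sS cs].
  have us : dot u s = dot u x.
    by apply: (@avg_exposed u S c) => // [w /SV/VP/ub|]; rewrite -?xE.
  have -> : y = r - u by rewrite /u opprB addrC subrK.
  by rewrite dotBl [dot u _]dotBr uv us subrr subr0 rg.
rewrite -enorm_sqr -exprMn => dg; rewrite lerXn2r // nnegrE.
  by rewrite mulr_ge0 ?sqrtr_ge0 // ltW.
by apply: le_trans dg; rewrite mulr_ge0 ?sqrtr_ge0 // ltW.
Qed.

End Pyramid.

(** * Smooth convex functions and line search *)

Section SmoothConvex.
Context {R : realType} {d : nat}.
Variables (f : 'rV[R]_d -> R) (L : R).
Hypotheses (f_smooth : smooth L f) (f_convex : @convex_function R 'rV[R]_d setT f).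
Implicit Types (x y e : 'rV[R]_d).

Lemma convex_along x e a b t : 0 <= t <= 1 ->
  f (x - (t * a + (1 - t) * b) *: e) <=
  t * f (x - a *: e) + (1 - t) * f (x - b *: e).
Proof.
move=> /andP[t0 t1].
have := f_convex (Itv01 t0 t1) (in_setT (x - a *: e)) (in_setT (x - b *: e)).
congr (f _ <= _); rewrite [LHS](_ : _ = t *: (x - a *: e) + (1 - t) *: (x - b *: e)) //.
by apply/rowP => i; rewrite !mxE; ring.
Qed.

Lemma smooth_along x e l :
  f (x - l *: e) <= f x - l * dot (grad f x) e + l ^+ 2 / 2 * (L * dot e e).
Proof.
have := f_smooth x (x - l *: e).
rewrite enorm_sqr [_ - x]addrAC subrr add0r dotNr dotNl dotNr !dotZl !dotZr.
by lra.
Qed.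

(** The gradient inequality follows from smoothness without differentiating:
    [x] is a convex combination of [y] and the point [x - t *: (y - x)], at which
    smoothness bounds [f] from above up to a second-order term, and [t] tends
    to [0]. *)
Lemma convex_first_order x y : dot (grad f x) (y - x) <= f y - f x.
Proof.
set Q := L * dot (x - y) (x - y); set e := f x + dot (grad f x) (y - x) - f y.
have small t : 0 < t -> e <= t * `|Q|.
  move=> t0; have t1_gt0 : 0 < 1 + t by lra.
  have t1 : 1 + t != 0 by rewrite gt_eqF.
  have yE : f (x - (- 1) *: (y - x)) = f y by rewrite scaleN1r opprK addrC subrK.
  have := smooth_along x (y - x) t.
  have := @convex_along x (y - x) t (- 1) ((1 + t)^-1).
  have -> : (1 + t)^-1 * t + (1 - (1 + t)^-1) * - 1 = 0 by field.
  rewrite scale0r subr0 yE -[y - x]opprB dotNl !dotNr opprK -/Q => H H1.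
  have it : 0 <= (1 + t)^-1 <= 1.
    by rewrite invr_ge0 invf_le1; lra.
  have H2 : (1 + t) * f x <= f (x - t *: - (x - y)) + t * f y.
    have := ler_wpM2l (ltW t1_gt0) (H it).
    by congr (_ <= _); field.
  have QQ := ler_norm Q.
  have te : t * e <= t * (t * `|Q|).
    rewrite /e -[y - x]opprB dotNr.
    have : t ^+ 2 / 2 * Q <= t * (t * `|Q|).
      by rewrite mulrA -expr2 -mulrA ler_wpM2l ?sqr_ge0 //; have := normr_ge0 Q; lra.
    lra.
  by move: te; rewrite (ler_pM2l t0).
rewrite -subr_ge0 leNgt; apply/negP => h.
have e0 : 0 < e by rewrite /e; lra.
have Q0 : 0 <= `|Q| by [].
have := small (e / (2 * (`|Q| + 1))).
have q1 : 0 < 2 * (`|Q| + 1) by lra.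
rewrite divr_gt0 // => /(_ isT).
by rewrite mulrAC ler_pdivlMr //; nra.
Qed.

Lemma line_search_le x e m l : line_search f x e m l ->
  forall k, 0 <= k <= m -> f (x - l *: e) <= f (x - k *: e).
Proof. by move=> [_ ls] k km; apply: ls; rewrite /= in_itv. Qed.

Lemma line_search_nincr x e m l : line_search f x e m l ->
  [/\ 0 <= l, l <= m & f (x - l *: e) <= f x].
Proof.
move=> ls; have := ls.1; rewrite /= in_itv /= => /andP[l0 lm]; split=> //.
have := line_search_le ls (k := 0); rewrite scale0r subr0; apply.
by rewrite lexx (le_trans l0 lm).
Qed.

(** A minimizer over [[0, m]] that is not the right end [m] cannot be improved
    beyond [m] either, because [f] is convex along the line. *)
Lemma line_search_interior x e m l : line_search f x e m l -> l < m ->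
  forall k, 0 <= k -> f (x - l *: e) <= f (x - k *: e).
Proof.
move=> ls lm k k0; have [l0 _ _] := line_search_nincr ls.
have [km|mk] := leP k m; first by rewrite (line_search_le ls) // k0.
have kl : 0 < k - l by lra.
pose t := (k - m) / (k - l).
have t01 : 0 <= t <= 1.
  by rewrite /t divr_ge0 ?(ltW kl) ?subr_ge0 ?(ltW mk) // ler_pdivrMr //= ; lra.
have t1 : 0 < 1 - t by rewrite subr_gt0 /t ltr_pdivrMr //; lra.
have := @convex_along x e l k t t01.
have -> : t * l + (1 - t) * k = m by rewrite /t; field; rewrite gt_eqF.
have := line_search_le ls (k := m); rewrite lexx (le_trans l0 (ltW lm)) => /(_ isT).
by nra.
Qed.

(** The step [g / M] minimizes the parabola [- g * k + M / 2 * k ^+ 2] that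
    dominates the variation of [f]; any step which is at least as good gains the
    same amount. *)
Lemma sufficient_decrease x e l M g : 0 < M -> L * dot e e <= M ->
  0 <= g <= dot (grad f x) e ->
  f (x - l *: e) <= f (x - (g / M) *: e) ->
  f (x - l *: e) <= f x - g ^+ 2 / (2 * M).
Proof.
move=> M0 LM /andP[g0 ge] le_l; apply: le_trans le_l _.
apply: le_trans (smooth_along _ _ _) _.
have k0 : 0 <= g / M by rewrite divr_ge0 // ltW.
have k2 : 0 <= (g / M) ^+ 2 / 2 by rewrite divr_ge0 // sqr_ge0.
have -> : g ^+ 2 / (2 * M) = g / M * g - (g / M) ^+ 2 / 2 * M.
  by field; rewrite gt_eqF.
have := ler_wpM2l k0 ge; have := ler_wpM2l k2 LM; lra.
Qed.

End SmoothConvex.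

(** The norm on row vectors is the sup norm, so compactness bounds coordinates. *)
Lemma compact_dot_bounded (R : realType) (d : nat) (P : set 'rV[R]_d) :
  compact P -> exists B, forall x y, P x -> P y -> dot (x - y) (x - y) <= B.
Proof.
move=> /compact_bounded /pinfty_ex_gt0 [N _ PN].
exists (\sum_(i < d) (2 * N) ^+ 2) => x y Px Py; apply: ler_sum => i _.
have coord z : P z -> `|z 0 i| <= N.
  move=> /PN; apply: le_trans.
  rewrite [leRHS](_ : _ = mx_norm z) // mx_normrE; apply/bigmax_geP; right.
  by exists (0, i).
rewrite -expr2 -real_normK ?num_real // lerXn2r ?nnegrE ?normr_ge0 //.
  by rewrite mulr_ge0 // (le_trans _ (coord _ Px)).
rewrite !mxE (le_trans (ler_normB _ _)) //.
by have := coord _ Px; have := coord _ Py; lra.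
Qed.

(** * One step of the algorithm *)

Section Steps.
Context {R : realType} {d : nat}.
Variables (f : 'rV[R]_d -> R) (P V : set 'rV[R]_d) (J : R).
Implicit Types (st : bpcg_state R d) (a s w x : 'rV[R]_d).

(** The explicit convex combination that the algorithm maintains.  Weights vanish
    outside the active set so that sums can be taken over any larger set. *)
Definition well_weighted st :=
  [/\ [set` active st] `<=` V,
    forall v, 0 <= weight st v,
    forall v, v \notin active st -> weight st v = 0,
    \sum_(v <- active st) weight st v = 1
  & iterate st = \sum_(v <- active st) weight st v *: v].

(** What the failure of both tests says when a gap step is taken.  The last
    bound adds the two failed tests; it is the gap which the pyramidal width
    controls. *)
Definition small_gaps st := exists a w,
  [/\ away_vertex f st a, fw_vertex f V st w,
    dot (grad f (iterate st)) (iterate st - w) < gap st / J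
  & dot (grad f (iterate st)) (a - w) < gap st + gap st / J].

Lemma well_weighted_conv st : well_weighted st -> conv_hull V (iterate st).
Proof. by move=> [SV c0 _ c1 xE]; exists (active st), (weight st); split. Qed.

(** Stated for a general [F] so that it gives both the total weight
    ([F] constant) and the iterate ([F] the identity).  The hypothesis [a != s]
    ensures that the weight of a dropped vertex is indeed zero. *)
Lemma sum_pairwise_update (U : lmodType R) (F : 'rV[R]_d -> U) st a s lam :
  a \in active st -> s \in active st -> a != s -> lam <= weight st a ->
  let st' := pairwise_update st a s lam in
  \sum_(v <- active st') weight st' v *: F v =
  \sum_(v <- active st) weight st v *: F v - lam *: (F a - F s).
Proof.
move=> aS sS a_s lam_a st'.
transitivity (\sum_(v <- active st) weight st' v *: F v).
  rewrite /st' /=; case: ltP => // a_lam.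
  apply: big_fset_incl; first exact: fsubD1set.
  move=> v vS; rewrite in_fsetD1 vS andbT negbK => /eqP ->.
  have -> : lam = weight st a by apply/eqP; rewrite eq_le lam_a.
  by rewrite eqxx (negbTE a_s) mulr1 mulr0 addr0 subrr scale0r.
rewrite /st' /=; under eq_bigr => v _ do rewrite scalerDl scalerBl.
rewrite big_split /= sumrB (sum_indic _ F aS) (sum_indic _ F sS) scalerBr.
by rewrite opprB addrA addrAC.
Qed.

Lemma sum_fw_update (U : lmodType R) (F : 'rV[R]_d -> U) st w lam :
  (w \notin active st -> weight st w = 0) ->
  let st' := fw_update st w lam in
  \sum_(v <- active st') weight st' v *: F v =
  (1 - lam) *: (\sum_(v <- active st) weight st v *: F v) + lam *: F w.
Proof.
move=> w0; rewrite /=; under eq_bigr => v _ do rewrite scalerDl -(scalerA (1 - lam)).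
rewrite big_split /= (sum_indic _ F (fset1U1 w _)) -scaler_sumr sum_fsetU1 //.
by move=> /w0 ->; rewrite scale0r.
Qed.

Lemma sum_weight st : \sum_(v <- active st) weight st v =
  \sum_(v <- active st) weight st v *: (1 : R^o).
Proof. by apply: eq_bigr => v _; rewrite [RHS]mulr1. Qed.

Lemma pairwise_well_weighted st a s lam :
  a \in active st -> s \in active st -> a != s -> 0 <= lam <= weight st a ->
  well_weighted st -> well_weighted (pairwise_update st a s lam).
Proof.
move=> aS sS a_s /andP[lam0 lam_a] [SV c0 out c1 xE].
have sumE U F := @sum_pairwise_update U F st a s lam aS sS a_s lam_a.
split.
- move=> v /=; case: ifP => _; first exact: SV.
  by rewrite in_fsetD1 => /andP[_ /SV].
- move=> v /=; rewrite addr_ge0 ?mulr_ge0 ?ler0n // subr_ge0.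
  by case: eqP => [->|_]; rewrite ?mulr1 ?mulr0.
- move=> v /=; case: ltP => a_lam vS.
    have va : v != a by apply: contraNneq vS => ->.
    have vs : v != s by apply: contraNneq vS => ->.
    by rewrite (negbTE va) (negbTE vs) out // !mulr0 subrr addr0.
  have vs : v != s by apply: contraNneq vS => ->; rewrite in_fsetD1 eq_sym a_s.
  rewrite (negbTE vs) mulr0 addr0; case: eqP => va.
    by rewrite va mulr1; apply/eqP; rewrite subr_eq0 eq_le a_lam lam_a.
  rewrite mulr0 subr0 out //; apply: contra vS => vS.
  by rewrite in_fsetD1 vS andbT; apply/eqP.
- by rewrite sum_weight sumE -sum_weight subrr scaler0 subr0.
- by rewrite sumE -xE.
Qed.

Lemma fw_well_weighted st w lam : V w -> 0 <= lam <= 1 ->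
  well_weighted st -> well_weighted (fw_update st w lam).
Proof.
move=> Vw /andP[lam0 lam1] [SV c0 out c1 xE].
have sumE U F := @sum_fw_update U F st w lam (out w).
split.
- by move=> v /=; rewrite in_fset1U => /orP[/eqP ->|/SV].
- by move=> v /=; rewrite addr_ge0 ?mulr_ge0 ?ler0n ?subr_ge0.
- move=> v /=; rewrite in_fset1U negb_or => /andP[/negbTE -> /out ->].
  by rewrite !mulr0 addr0.
- rewrite sum_weight sumE -sum_weight c1.
  rewrite -[LHS]/((1 - lam) * 1 + lam * 1); ring.
- by rewrite sumE -xE /= scalerBl scale1r scalerBr opprB addrA addrAC.
Qed.

(** A positive gap estimate rules out pairwise steps with [a = s]. *)
Lemma step_well_weighted st st' : 0 < gap st ->
  well_weighted st -> bpcg_step f V J st st' -> well_weighted st'.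
Proof.
move=> gap0 ww [a s lam [aS _] [sS _] gap_le ls|a s w lam _ _ _ [Vw _] _ ls|//].
  have := ls.1; rewrite /= in_itv /= => lam_itv.
  apply: pairwise_well_weighted => //; apply: contraTneq gap_le => ->.
  by rewrite subrr dot0r -ltNge.
by have := ls.1; rewrite /= in_itv /= => lam_itv; apply: fw_well_weighted.
Qed.

Variables (L M : R).
Hypotheses (f_smooth : smooth L f) (f_convex : @convex_function R 'rV[R]_d setT f).
Hypotheses (V_sub_P : V `<=` P) (P_conv_V : P = conv_hull V).
Hypotheses (J_ge1 : 1 <= J) (M_gt0 : 0 < M).
Hypothesis curvature : forall x y, P x -> P y -> L * dot (x - y) (x - y) <= M.

Lemma fw_vertex_le st w z : fw_vertex f V st w -> P z ->
  dot (grad f (iterate st)) w <= dot (grad f (iterate st)) z.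
Proof.
move=> [_ wmin] Pz; rewrite -lerN2 -!dotNl.
rewrite P_conv_V in Pz; apply: dot_conv_hull_le Pz _ => v Vv.
by rewrite !dotNl lerN2 wmin.
Qed.

Lemma primal_gap_le_fw st w z : fw_vertex f V st w -> P z ->
  f (iterate st) - f z <= dot (grad f (iterate st)) (iterate st - w).
Proof.
move=> fw Pz; have := convex_first_order f_smooth f_convex (iterate st) z.
by have := fw_vertex_le fw Pz; rewrite !dotBr; lra.
Qed.

(** The three kinds of steps as the convergence proof sees them; a productive
    pairwise step and a Frank-Wolfe step are both of kind [Decrease]. *)
Inductive step_outcome st st' : Prop :=
| Drop of gap st' = gap st & f (iterate st') <= f (iterate st)
    & (#|` active st'| < #|` active st|)%N
| Decrease of gap st' = gap st
    & f (iterate st') <= f (iterate st) - (gap st / J) ^+ 2 / (2 * M)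
    & (#|` active st'| <= #|` active st|.+1)%N
| Halving of gap st' = gap st / 2 & iterate st' = iterate st
    & active st' = active st & small_gaps st.

Lemma step_outcomeP st st' : well_weighted st -> 0 < gap st -> gap st <= J * M ->
  bpcg_step f V J st st' -> step_outcome st st'.
Proof.
move=> ww gap0 gapM.
have J0 : 0 < J := lt_le_trans ltr01 J_ge1.
have gJ0 : 0 <= gap st / J by rewrite divr_ge0 // ltW.
have gJ : gap st / J <= gap st by rewrite ler_pdivrMr // ler_peMr // ltW.
have Px : P (iterate st) by rewrite P_conv_V; apply: well_weighted_conv.
case: (ww) => SV _ _ _ xE.
case=> [a s lam [aS _] [sS _] gap_le ls|a s w lam _ _ _ [Vw _] gap_le ls|
        a s w aP [_ smin] gap_lt wP gap_w].
- have [lam0 lam_a fle] := line_search_nincr ls.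
  have [lt_a|a_lt] := ltP lam (weight st a); last first.
    apply: Drop => //=; rewrite ltNge a_lt /= [X in (_ < X)%N](cardfsD1 a) aS.
    by rewrite add1n.
  apply: Decrease; rewrite //= ?lt_a //.
  apply: sufficient_decrease => //.
  + by apply: curvature; apply/V_sub_P/SV.
  + by rewrite gJ0 (le_trans gJ).
  + by apply: (line_search_interior f_convex ls) => //; rewrite divr_ge0 // ltW.
- apply: Decrease => //=; last by rewrite cardfsU1; case: (_ \in _); rewrite ?leqnSn.
  apply: sufficient_decrease => //.
  + by apply: curvature => //; apply: V_sub_P.
  + by rewrite gJ0.
  + apply: (line_search_le ls); rewrite divr_ge0 ?(ltW M_gt0) //=.
    by rewrite ler_pdivrMr // mul1r ler_pdivrMr // mulrC.
- apply: Halving => //; exists a, w; split=> //.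
  have sx : dot (grad f (iterate st)) s <= dot (grad f (iterate st)) (iterate st).
    rewrite -lerN2 -!dotNl xE; case: ww => _ c0 _ c1 _; rewrite -xE {2}xE.
    by apply: dot_avg_le => // v vS; rewrite !dotNl lerN2 smin.
  by move: gap_lt gap_w; rewrite !dotBr; lra.
Qed.

Lemma halving_gap_bound st z : 0 < gap st -> small_gaps st -> P z ->
  f (iterate st) - f z <= gap st.
Proof.
move=> gap0 [a [w [_ wP gw _]]] Pz; apply: le_trans (primal_gap_le_fw wP Pz) _.
apply: le_trans (ltW gw) _; rewrite ler_pdivrMr ?(lt_le_trans ltr01 J_ge1) //.
by rewrite ler_peMr // ltW.
Qed.

End Steps.

Lemma bigO_eventually_le (R : realType) (h g : nat -> R) (k : R) (N : nat) :
  0 < k -> (forall t, (N <= t)%N -> 0 <= h t <= k * g t) -> h =O_\oo g.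
Proof.
move=> k0 hg; apply/eqO_exP; exists k => //; exists N => // t /= Nt.
have /andP[h0 hk] := hg t Nt.
have g0 : 0 <= g t by rewrite -(pmulr_rge0 _ k0) (le_trans h0).
by rewrite !ger0_norm.
Qed.

(** * Convergence of a run *)

Section Run.
Context {R : realType} {d : nat}.
Variables (f : 'rV[R]_d -> R) (P V : set 'rV[R]_d) (J L : R) (xstar : 'rV[R]_d).
Variable st : nat -> bpcg_state R d.
Hypotheses (f_smooth : smooth L f) (f_convex : @convex_function R 'rV[R]_d setT f).
Hypotheses (V_sub_P : V `<=` P) (P_conv_V : P = conv_hull V).
Hypotheses (J_ge1 : 1 <= J) (xstar_min : argmin P f xstar).
Hypothesis st_run : bpcg_run f P V J st.

Let h t := f (iterate (st t)) - f xstar.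

Lemma start_gap : 0 <= gap (st 0) /\ h 0 <= 2 * gap (st 0).
Proof.
rewrite /h; have [[x0 [v0 [/V_sub_P Px0 [_ v0max] ->]]] _] := st_run => /=.
have := v0max _ Px0; rewrite subrr dot0r => g0; split; first by rewrite mulr_ge0.
have := v0max _ xstar_min.1.
have := convex_first_order f_smooth f_convex x0 xstar.
by rewrite !dotBr; lra.
Qed.

Lemma start_well_weighted : well_weighted V (st 0).
Proof.
have [[x0 [v0 [Vx0 _ ->]]] _] := st_run; split=> /=.
- by move=> v /=; rewrite in_fset1 => /eqP ->.
- by move=> v; rewrite ler0n.
- by move=> v; rewrite in_fset1 => /negbTE ->.
- by rewrite big_seq_fset1 eqxx.
- by rewrite big_seq_fset1 eqxx scale1r.
Qed.

Lemma start_card : #|` active (st 0)| = 1%N.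
Proof. by have [[x0 [v0 [_ _ ->]]] _] := st_run; rewrite /= cardfs1. Qed.

(** When the initial estimate is zero, the start is optimal, and the pairwise
    test always succeeds with [a = s], so the run never moves. *)
Lemma iterate_const_gap0 : gap (st 0) = 0 ->
  forall t, iterate (st t) = iterate (st 0).
Proof.
move=> gap0.
have [x0 act0] : exists x, forall v, v \in active (st 0) -> v = x.
  have [[x0 [v0 [_ _ ->]]] _] := st_run.
  by exists x0 => v /=; rewrite in_fset1 => /eqP.
suff H t : [/\ gap (st t) = 0, iterate (st t) = iterate (st 0)
    & forall v, v \in active (st t) -> v = x0].
  by move=> t; have [] := H t.
elim: t => [//|t [gt xt act]]; have := st_run.2 t.
have same a s : away_vertex f (st t) a -> local_fw_vertex f (st t) s ->
    dot (grad f (iterate (st t))) (a - s) = 0.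
  by move=> [/act -> _] [/act -> _]; rewrite subrr dot0r.
case=> [a s lam [aS _] [sS _] _ _|a s w lam aP sP + _ _ _|a s w aP sP + _ _];
  [|by rewrite (same a s) // gt ltxx..].
split=> //=; first by rewrite (act a) // (act s) // subrr scaler0 subr0.
by move=> v; case: ifP => _; [exact: act|rewrite in_fsetD1 => /andP[_ /act]].
Qed.

Variable M : R.
Hypotheses (M_gt0 : 0 < M) (gap_pos : 0 < gap (st 0)) (gap_le : gap (st 0) <= J * M).
Hypothesis curvature : forall x y, P x -> P y -> L * dot (x - y) (x - y) <= M.

Lemma primal_gap_ge0 t : well_weighted V (st t) -> 0 <= h t.
Proof.
move=> /well_weighted_conv; rewrite -P_conv_V subr_ge0 => Px.
exact: xstar_min.2.
Qed.

Lemma run_invariant t : [/\ well_weighted V (st t), 0 < gap (st t),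
  gap (st t) <= gap (st 0) & 0 <= h t <= 2 * gap (st t)].
Proof.
elim: t => [|t [ww g0 gle /andP[_ hle]]].
  have ww := start_well_weighted.
  by split; rewrite // primal_gap_ge0 //; exact: start_gap.2.
have ww' := step_well_weighted g0 ww (st_run.2 t).
have := step_outcomeP f_smooth f_convex V_sub_P P_conv_V J_ge1 M_gt0 curvature
  ww g0 (le_trans gle gap_le) (st_run.2 t).
have H : 0 < gap (st t.+1) -> gap (st t.+1) <= gap (st t) ->
    h t.+1 <= 2 * gap (st t.+1) ->
  [/\ well_weighted V (st t.+1), 0 < gap (st t.+1),
    gap (st t.+1) <= gap (st 0) & 0 <= h t.+1 <= 2 * gap (st t.+1)].
  by move=> a b c; split=> //; rewrite ?primal_gap_ge0 //; apply: le_trans gle.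
have sq : 0 <= (gap (st t) / J) ^+ 2 / (2 * M).
  by rewrite divr_ge0 ?sqr_ge0 ?mulr_ge0 // ltW.
case=> [gE fle _|gE fle _|gE xE _ sg]; apply: H; rewrite ?gE //.
- by move: hle; rewrite /h; lra.
- by move: hle; rewrite /h; lra.
- by rewrite divr_gt0.
- by lra.
- have := halving_gap_bound f_smooth f_convex P_conv_V J_ge1 g0 sg xstar_min.1.
  by rewrite /h xE; lra.
Qed.

Let kappa := (2 * M * J ^+ 2)^-1.

(** [psi] is arbitrary here because only its jump on gap steps depends on the
    regime.  The constant [3] is the increment [4 - 1] of the factor of
    [h / gap ^+ 2] when the estimate is halved. *)
Lemma potential_growth (psi : R -> R) (rho : R) : 0 <= rho -> rho <= kappa ->
  (forall t, small_gaps f V J (st t) ->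
    rho + 3 * (h t / gap (st t) ^+ 2) <= psi (gap (st t) / 2) - psi (gap (st t))) ->
  forall t, psi (gap (st 0)) - h 0 / gap (st 0) ^+ 2 - rho / 2 + rho / 2 * t%:R
    <= psi (gap (st t)).
Proof.
move=> rho0 rhok jump t.
pose E t := psi (gap (st t)) - h t / gap (st t) ^+ 2 - rho / 2 * #|` active (st t)|%:R.
suff grow : E 0 + rho / 2 * t%:R <= E t.
  have [_ g0 _ /andP[h0 _]] := run_invariant t.
  have : 0 <= h t / gap (st t) ^+ 2 by rewrite divr_ge0 // sqr_ge0.
  have : 0 <= rho / 2 * #|` active (st t)|%:R by rewrite mulr_ge0 // divr_ge0.
  by move: grow; rewrite /E start_card mulr1; lra.
elim: t => [|t IH]; first by rewrite mulr0 addr0.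
apply: (@le_trans _ _ (E t + rho / 2)).
  by rewrite -[t.+1%:R]natr1 mulrDr mulr1 addrA lerD2r.
have [ww g0 gle /andP[hge0 hle]] := run_invariant t.
have g2 : 0 < (gap (st t) ^+ 2)^-1 by rewrite invr_gt0 exprn_gt0.
have := step_outcomeP f_smooth f_convex V_sub_P P_conv_V J_ge1 M_gt0 curvature
  ww g0 (le_trans gle gap_le) (st_run.2 t).
rewrite /E; case=> [gE fle card|gE fle card|gE xE aE sg].
- rewrite gE; have : h t.+1 / gap (st t) ^+ 2 <= h t / gap (st t) ^+ 2.
    by rewrite ler_pM2r // /h lerD2r.
  have : rho / 2 * (#|` active (st t.+1)|%:R + 1) <= rho / 2 * #|` active (st t)|%:R.
    by rewrite ler_wpM2l ?divr_ge0 // natr1 ler_nat.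
  by lra.
- rewrite gE; have : h t.+1 / gap (st t) ^+ 2 <= h t / gap (st t) ^+ 2 - kappa.
    have -> : kappa = (gap (st t) / J) ^+ 2 / (2 * M) / gap (st t) ^+ 2.
      by rewrite /kappa; field; rewrite !gt_eqF // (lt_le_trans ltr01).
    by rewrite -mulrBl ler_pM2r // /h; move: fle; lra.
  have : rho / 2 * #|` active (st t.+1)|%:R <= rho / 2 * (#|` active (st t)|%:R + 1).
    by rewrite ler_wpM2l ?divr_ge0 // natr1 ler_nat.
  by lra.
- have := jump t sg; rewrite gE aE /h xE -/(h t).
  have -> : h t / (gap (st t) / 2) ^+ 2 = 4 * (h t / gap (st t) ^+ 2).
    by field; rewrite gt_eqF.
  by lra.
Qed.

Lemma sublinear_rate : h =O_\oo (fun T : nat => T%:R^-1 : R).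
Proof.
have J0 : 0 < J := lt_le_trans ltr01 J_ge1.
have k0 : 0 < kappa by rewrite invr_gt0 !mulr_gt0 ?exprn_gt0.
pose rho := Num.min kappa (gap (st 0))^-1.
have rho0 : 0 < rho by rewrite lt_min k0 invr_gt0.
have rhog : rho <= (gap (st 0))^-1 by rewrite ge_min lexx orbT.
apply: (@bigO_eventually_le _ _ _ (32 / rho) 2); first by rewrite divr_gt0.
move=> t t2; have [_ g0 gle /andP[hge0 hle]] := run_invariant t; rewrite hge0 /=.
have := @potential_growth (fun g => 4 / g) rho (ltW rho0).
rewrite ge_min lexx => /(_ isT) growth.
have {}growth : 4 / gap (st 0) - h 0 / gap (st 0) ^+ 2 - rho / 2 + rho / 2 * t%:R
    <= 4 / gap (st t).
  apply: growth => k sg.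
  have [_ gk0 gkle _] := run_invariant k.
  have hk := halving_gap_bound f_smooth f_convex P_conv_V J_ge1 gk0 sg xstar_min.1.
  have : h k / gap (st k) ^+ 2 <= (gap (st k))^-1.
    by rewrite ler_pdivrMr ?exprn_gt0 // expr2 mulrA mulVf ?mul1r // gt_eqF.
  have : rho <= (gap (st k))^-1.
    by apply: le_trans rhog _; rewrite lef_pV2.
  have -> : 4 / (gap (st k) / 2) = 8 * (gap (st k))^-1.
    by field; rewrite gt_eqF.
  by lra.
have h0 : h 0 / gap (st 0) ^+ 2 <= 2 / gap (st 0).
  rewrite ler_pdivrMr ?exprn_gt0 // expr2 mulrA mulfVK ?gt_eqF //.
  exact: start_gap.2.
have t2R : 2 <= t%:R :> R by rewrite ler_nat.
have : rho / 4 * t%:R <= 4 / gap (st t).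
  have : 0 < 2 / gap (st 0) by rewrite divr_gt0.
  have : 4 / gap (st 0) = 2 * (2 / gap (st 0)) by ring.
  have : 0 <= rho * (t%:R - 2) by rewrite mulr_ge0 ?subr_ge0 // ltW.
  by lra.
rewrite ler_pdivlMr // => key.
apply: le_trans hle _.
rewrite -mulrA -invfM ler_pdivlMr ?mulr_gt0 //; last by rewrite (lt_le_trans _ t2R).
by nra.
Qed.

Lemma linear_rate (C : R) : 0 < C ->
  (forall t, small_gaps f V J (st t) -> h t <= C * gap (st t) ^+ 2) ->
  exists2 c : R, 0 < c & h =O_\oo (fun T : nat => expR (- (c * T%:R))).
Proof.
move=> C0 hC.
have J0 : 0 < J := lt_le_trans ltr01 J_ge1.
have k0 : 0 < kappa by rewrite invr_gt0 !mulr_gt0 ?exprn_gt0.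
have ln2 : 0 < ln 2 :> R by apply: ln_gt0; rewrite ltr1n.
pose K := (kappa + 3 * C) / ln 2.
have K0 : 0 < K by rewrite divr_gt0 // addr_gt0 // mulr_gt0.
exists (kappa / 2 / K); first by rewrite (divr_gt0 _ K0) // (divr_gt0 k0).
(* [B] collects the terms of the potential bound that do not depend on time. *)
pose B := (- (K * ln (gap (st 0)))) - h 0 / gap (st 0) ^+ 2 - kappa / 2.
apply: (@bigO_eventually_le _ _ _ (2 * expR (- (B / K))) 0).
  by rewrite mulr_gt0 ?expR_gt0.
move=> t _; have [_ g0 gle /andP[hge0 hle]] := run_invariant t; rewrite hge0 /=.
have growth : B + kappa / 2 * t%:R <= - (K * ln (gap (st t))).
  apply: (potential_growth (psi := fun g => - (K * ln g)) (ltW k0) (lexx _)) => k sg.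
  have [_ gk0 _ _] := run_invariant k.
  have : h k / gap (st k) ^+ 2 <= C by rewrite ler_pdivrMr ?exprn_gt0 // hC.
  rewrite ln_div ?posrE //.
  have : K * ln 2 = kappa + 3 * C by rewrite /K divfK // gt_eqF.
  by lra.
apply: le_trans hle _; rewrite -mulrA -expRD ler_pM2l //.
rewrite -[leLHS]lnK ?posrE // ler_expR -(ler_pM2l K0).
have -> : K * (- (B / K) - kappa / 2 / K * t%:R) = - (B + kappa / 2 * t%:R).
  by field; rewrite gt_eqF.
by lra.
Qed.

(** A small pairwise gap at [x] bounds the projected negative gradient [y]
    through the pyramidal width, and completing the square in
    [dot y e - mu / 2 * dot e e] removes the unknown direction [e]. *)
Lemma quadratic_gap_bound (mu del : R) :
  0 < mu -> strongly_convex mu f -> @convex_set R 'rV[R]_d P -> polytope P ->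
  V = vertices P -> 0 < del -> (del%:E <= pyramidal_width P)%E ->
  forall t, small_gaps f V J (st t) ->
    h t <= 2 / (mu * del ^+ 2) * gap (st t) ^+ 2.
Proof.
move=> mu0 sc Pconv Ppoly VE del0 del_le t [a [w [[_ amax] [_ wmin] _ gaw]]].
have [ww g0 _ _] := run_invariant t.
have Px : P (iterate (st t)) by rewrite P_conv_V; apply: well_weighted_conv.
case: (ww) => SV c0 _ c1 xE.
set x := iterate (st t) in xE Px amax wmin gaw *.
have gJ : gap (st t) / J <= gap (st t).
  by rewrite ler_pdivrMr ?(lt_le_trans ltr01 J_ge1) // ler_peMr // ltW.
rewrite VE in SV wmin.
have [|y [yP yg]] := pyramidal_gap Pconv Ppoly Px del0 del_le SV (fun v _ => c0 v) c1 xE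
  (r := - grad f x) (g := 2 * gap (st t)).
  move=> v s Vv sS; have := wmin v Vv; have := amax s sS.
  by move: gaw; rewrite !dotBr !dotNl; lra.
have := yP _ xstar_min.1; have := sc x xstar.
rewrite enorm_sqr dotNl /h -/x; move: (xstar - x) => e H1 H2.
have : f x - f xstar <= dot y e - mu / 2 * dot e e by lra.
move=> hb; have sq := dot_ge0 (y - mu *: e).
have {sq} : dot y e - mu / 2 * dot e e <= dot y y / (2 * mu).
  rewrite ler_pdivlMr ?mulr_gt0 //.
  by move: sq; rewrite !dotE (dotC e y); lra.
have : dot y y / (2 * mu) <= 2 / (mu * del ^+ 2) * gap (st t) ^+ 2.
  rewrite ler_pdivrMr ?mulr_gt0 //.
  have -> : 2 / (mu * del ^+ 2) * gap (st t) ^+ 2 * (2 * mu) =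
     (2 * gap (st t)) ^+ 2 / del ^+ 2 by field; rewrite !gt_eqF.
  by rewrite ler_pdivlMr ?exprn_gt0 // mulrC.
by lra.
Qed.

End Run.

(** * The convergence rates *)

Theorem theorem3p6 (R : realType) (d : nat) (P V : set 'rV[R]_d) (D : R)
    (f : 'rV[R]_d -> R) (L : R) (xstar : 'rV[R]_d) (J : R)
    (st : nat -> bpcg_state R d)
    (P_compact : compact P) (P_convex : @convex_set R 'rV[R]_d P)
    (P_diameter : D = diameter P)
    (V_sub_P : V `<=` P) (P_conv_V : P = conv_hull V)
    (f_diff : forall x : 'rV[R]_d, differentiable f x)
    (f_smooth : smooth L f)
    (f_convex : @convex_function R 'rV[R]_d setT f)
    (xstar_min : argmin P f xstar)
    (J_ge1 : 1 <= J)
    (st_run : bpcg_run f P V J st) :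
  (forall (mu : R) (delta : \bar R),
      0 < mu -> strongly_convex mu f ->
      polytope P -> V = vertices P ->
      delta = pyramidal_width P -> (0 < delta)%E ->
      exists2 c : R, 0 < c &
        (fun T : nat => f (iterate (st T)) - f xstar)
          =O_\oo (fun T : nat => expR (- (c * T%:R))))
  /\
  (fun T : nat => f (iterate (st T)) - f xstar)
    =O_\oo (fun T : nat => T%:R^-1 : R).
Proof.
have [gap0_ge0 h0_le] := start_gap f_smooth f_convex V_sub_P xstar_min st_run.
have [gap0|gap0_neq0] := eqVneq (gap (st 0%N)) 0.
  have constant t : f (iterate (st t)) - f xstar = 0.
    rewrite (iterate_const_gap0 st_run gap0); apply/eqP; rewrite eq_le.
    rewrite (le_trans h0_le) ?gap0 ?mulr0 //=.
    exact: (primal_gap_ge0 P_conv_V xstar_min (start_well_weighted st_run)).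
  split=> [mu delta _ _ _ _ _ _|]; first exists 1 => //.
    apply: (bigO_eventually_le (k := 1) (N := 0)) => // t _.
    by rewrite /= constant lexx mul1r expR_ge0.
  apply: (bigO_eventually_le (k := 1) (N := 0)) => // t _.
  by rewrite /= constant lexx mul1r invr_ge0 ler0n.
have gap0_gt0 : 0 < gap (st 0%N) by rewrite lt_neqAle eq_sym gap0_neq0.
have [B PB] := compact_dot_bounded P_compact.
(* The summand [gap (st 0)] makes the step [gap / (J * M)] admissible in the
   Frank-Wolfe line search, which is limited to [0, 1]. *)
pose M := `|L| * `|B| + gap (st 0%N).
have LB_ge0 : 0 <= `|L| * `|B| by rewrite mulr_ge0.
have M_gt0 : 0 < M by rewrite /M ltr_wpDl.
have gapM : gap (st 0%N) <= J * M.
  apply: (@le_trans _ _ M); first by rewrite /M lerDr.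
  by rewrite ler_peMl // ltW.
have curvature x y : P x -> P y -> L * dot (x - y) (x - y) <= M.
  move=> Px Py; apply: (@le_trans _ _ (`|L| * `|B|)); last by rewrite /M lerDl.
  apply: (@le_trans _ _ (`|L| * dot (x - y) (x - y))).
    by rewrite ler_wpM2r ?dot_ge0 ?ler_norm.
  by rewrite ler_wpM2l // (le_trans (PB _ _ Px Py)) ?ler_norm.
split; last first.
  exact: (sublinear_rate f_smooth f_convex V_sub_P P_conv_V J_ge1 xstar_min
    st_run M_gt0).
move=> mu delta mu0 sc Ppoly VE deltaE delta0.
(* The width is infinite when [P] is a point; then any positive number is a
   lower bound. *)
have [del del0 del_le] : exists2 del : R, 0 < del & (del%:E <= delta)%E.
  case: delta {deltaE} delta0 => [r r0|_|//]; first by exists r; rewrite // -lte_fin.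
  by exists 1; rewrite // leey.
apply: (linear_rate f_smooth f_convex V_sub_P P_conv_V J_ge1 xstar_min st_run
  M_gt0 gap0_gt0 gapM curvature (C := 2 / (mu * del ^+ 2))).
  by rewrite divr_gt0 // mulr_gt0 // exprn_gt0.
apply: (quadratic_gap_bound f_smooth f_convex V_sub_P P_conv_V J_ge1 xstar_min
  st_run M_gt0) => //.
by rewrite -deltaE.
Qed.
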